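(* Let $p=3$ with normalized data. For $s\in\mathbb R$ let $$\begin{pmatrix}\beta_1\\ \beta_2\\ \beta_3\end{pmatrix}=\begin{pmatrix}\hat\beta_1\\ \hat\beta_2\\ \hat\beta_3\end{pmatrix}+\frac1\Delta\begin{pmatrix}1-J_{23}^2&J_{13}J_{23}-J_{12}&J_{12}J_{23}-J_{13}\\ J_{13}J_{23}-J_{12}&1-J_{13}^2&J_{12}J_{13}-J_{23}\\ J_{12}J_{23}-J_{13}&J_{12}J_{13}-J_{23}&1-J_{12}^2\end{pmatrix}\begin{pmatrix}s\delta^1\\ s\delta^2\\ s\delta^3\end{pmatrix}\qquad( * )$$ with $\Delta=1+2J_{12}J_{13}J_{23}-J_{12}^2-J_{13}^2-J_{23}^2$, and let $s_i$ be the solution of the equation $\beta_i=0$, linear in $s$, for $i=1,2,3$: $$s_1=\frac{-J_{14}(1-J_{23}^2)-(J_{13}J_{23}-J_{12})J_{24}-(J_{12}J_{23}-J_{13})J_{34}}{(1-J_{23}^2)\delta^1+(J_{13}J_{23}-J_{12})\delta^2+(J_{12}J_{23}-J_{13})\delta^3},$$ $$s_2=\frac{-J_{24}(1-J_{13}^2)-(J_{13}J_{23}-J_{12})J_{14}-(J_{12}J_{13}-J_{23})J_{34}}{(1-J_{13}^2)\delta^2+(J_{13}J_{23}-J_{12})\delta^1+(J_{12}J_{13}-J_{23})\delta^3},$$ $$s_3=\frac{-J_{34}(1-J_{12}^2)-(J_{13}J_{12}-J_{23})J_{24}-(J_{12}J_{23}-J_{13})J_{14}}{(1-J_{12}^2)\delta^3+(J_{12}J_{13}-J_{23})\delta^2+(J_{12}J_{23}-J_{13})\delta^1}.$$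 Let $s_I$ be the one of $s_1,s_2,s_3$ that is negative and has minimal absolute value among all the negative values of $s_1,s_2,s_3$. Then for all $s$ with $s_I<s<0$ the solution of the lasso is given by $( * )$; that is, the vector $( * )$ is the lasso solution for the bound $t=|\beta_1|+|\beta_2|+|\beta_3|$.
   Context: Here $K_1=\begin{pmatrix}1&J_{12}&J_{13}\\ J_{12}&1&J_{23}\\ J_{13}&J_{23}&1\end{pmatrix}$ is the (positive definite) covariance matrix of the three centered, normalized predictors, $J_{14},J_{24},J_{34}$ are the correlations of the (standardized) response with the predictors, $b=(J_{14},J_{24},J_{34})^T$ and $\hat\beta=K_1^{-1}b$. The lasso solution for the bound $t>0$ is the minimizer of $\langle K_1\beta,\beta\rangle-2\langle b,\beta\rangle$ (equivalently of the least square objective function) over $\{\beta\in\mathbb R^3:|\beta_1|+|\beta_2|+|\beta_3|\le t\}$. All $\hat\beta_j$ are nonzero, and $\delta^j=+1$ if $\hat\beta_j>0$, $\delta^j=-1$ if $\hat\beta_j<0$. An index $i$ for which the denominator of $s_i$ vanishes is disregarded. *)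

(* Defs.v *)
From HB Require Import structures.
From mathcomp Require Import all_boot all_order all_algebra.

Set Implicit Arguments.
Unset Strict Implicit.
Unset Printing Implicit Defensive.

Import Order.TTheory GRing.Theory Num.Theory.
Local Open Scope ring_scope.

Definition inner (R : realFieldType) (n : nat) (u v : 'cV[R]_n) : R :=
  \sum_i u i 0 * v i 0.

Definition l1norm (R : realFieldType) (n : nat) (u : 'cV[R]_n) : R :=
  \sum_i `|u i 0|.

Definition posdefmx (R : realFieldType) (n : nat) (K : 'M[R]_n) : Prop :=
  K^T = K /\ forall v : 'cV[R]_n, v != 0 -> 0 < inner (K *m v) v.

(* For centered and normalized data with predictor covariance matrix K and
   predictor-response correlations b, this is the mean squared error of beta
   up to the additive constant given by the variance of the response. *)
Definition lasso_objective (R : realFieldType) (n : nat)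
    (K : 'M[R]_n) (b beta : 'cV[R]_n) : R :=
  inner (K *m beta) beta - 2%:R * inner b beta.

Definition lasso_minimizer (R : realFieldType) (n : nat)
    (K : 'M[R]_n) (b : 'cV[R]_n) (t : R) (beta : 'cV[R]_n) : Prop :=
  l1norm beta <= t /\
  forall beta' : 'cV[R]_n, l1norm beta' <= t ->
    lasso_objective K b beta <= lasso_objective K b beta'.

Definition lasso_solution (R : realFieldType) (n : nat)
    (K : 'M[R]_n) (b : 'cV[R]_n) (t : R) (beta : 'cV[R]_n) : Prop :=
  unique (lasso_minimizer K b t) beta.

(* Indices in 'I_3 start at 0: index i stands for the predictor i + 1. *)
Definition col3 (R : realFieldType) (x1 x2 x3 : R) : 'cV[R]_3 :=
  \col_i [:: x1; x2; x3]`_i.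

Definition mx3 (R : realFieldType)
    (a11 a12 a13 a21 a22 a23 a31 a32 a33 : R) : 'M[R]_3 :=
  \matrix_(i, j) nth 0 (nth [::] [:: [:: a11; a12; a13];
                                     [:: a21; a22; a23];
                                     [:: a31; a32; a33]] i) j.

Definition cov3 (R : realFieldType) (J12 J13 J23 : R) : 'M[R]_3 :=
  mx3 1   J12 J13
      J12 1   J23
      J13 J23 1.

Definition Delta3 (R : realFieldType) (J12 J13 J23 : R) : R :=
  1 + 2%:R * J12 * J13 * J23 - J12 ^+ 2 - J13 ^+ 2 - J23 ^+ 2.

Definition cofactor3 (R : realFieldType) (J12 J13 J23 : R) : 'M[R]_3 :=
  mx3 (1 - J23 ^+ 2)    (J13 * J23 - J12) (J12 * J23 - J13)
      (J13 * J23 - J12) (1 - J13 ^+ 2)    (J12 * J13 - J23)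
      (J12 * J23 - J13) (J12 * J13 - J23) (1 - J12 ^+ 2).

Definition lasso_path (R : realFieldType) (J12 J13 J23 : R)
    (betahat delta : 'cV[R]_3) (s : R) : 'cV[R]_3 :=
  betahat + (Delta3 J12 J13 J23)^-1 *:
    (cofactor3 J12 J13 J23 *m
       col3 (s * delta 0 0) (s * delta 1 0) (s * delta 2%:R 0)).

Definition crossing_num (R : realFieldType) (J12 J13 J23 J14 J24 J34 : R)
    (i : 'I_3) : R :=
  [:: - J14 * (1 - J23 ^+ 2) - (J13 * J23 - J12) * J24
        - (J12 * J23 - J13) * J34;
      - J24 * (1 - J13 ^+ 2) - (J13 * J23 - J12) * J14
        - (J12 * J13 - J23) * J34;
      - J34 * (1 - J12 ^+ 2) - (J13 * J12 - J23) * J24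
        - (J12 * J23 - J13) * J14 ]`_i.

Definition crossing_den (R : realFieldType) (J12 J13 J23 : R)
    (delta : 'cV[R]_3) (i : 'I_3) : R :=
  let d1 := delta 0 0 in let d2 := delta 1 0 in let d3 := delta 2%:R 0 in
  [:: (1 - J23 ^+ 2) * d1 + (J13 * J23 - J12) * d2 + (J12 * J23 - J13) * d3;
      (1 - J13 ^+ 2) * d2 + (J13 * J23 - J12) * d1 + (J12 * J13 - J23) * d3;
      (1 - J12 ^+ 2) * d3 + (J12 * J13 - J23) * d2 + (J12 * J23 - J13) * d1 ]`_i.

(* Division by zero returns 0, so indices with a zero denominator have to be
   excluded explicitly. *)
Definition nearest_negative (R : realFieldType) (m : nat)
    (den s : 'I_m -> R) (I : 'I_m) : Prop :=
  [/\ den I != 0, s I < 0 &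
      forall j, den j != 0 -> s j < 0 -> `|s I| <= `|s j|].

(* Main.v *)
(* Along the path, K beta(s) - b = s delta with delta the sign vector of the
   least squares solution.  Up to the first zero crossing below 0 the signs of
   beta(s) are still delta, so <delta, beta(s)> is the l1 norm of beta(s) while
   <delta, beta'> is at most that of beta'.  For s <= 0 and
   h = beta' - beta(s) the objective f then satisfies f(beta') - f(beta(s)) =
   <K h, h> + 2 s <delta, h> >= <K h, h>, positive unless h = 0.
   A negative crossing exists because <delta, K^-1 delta> > 0: some |beta_i(s)|
   decreases to 0 as s moves down from 0. *)
Require Import Defs.
From HB Require Import structures.
From mathcomp Require Import all_boot all_order all_algebra.
From mathcomp Require Import ring lra.

Set Implicit Arguments.
Unset Strict Implicit.
Unset Printing Implicit Defensive.

Import Order.TTheory GRing.Theory Num.Theory.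
Local Open Scope ring_scope.

Lemma innerC (R : realFieldType) (n : nat) (u v : 'cV[R]_n) :
  inner u v = inner v u.
Proof. by apply: eq_bigr => i _; rewrite mulrC. Qed.

Lemma innerDl (R : realFieldType) (n : nat) (u v w : 'cV[R]_n) :
  inner (u + v) w = inner u w + inner v w.
Proof. by rewrite -big_split; apply: eq_bigr => i _; rewrite mxE mulrDl. Qed.

Lemma innerDr (R : realFieldType) (n : nat) (u v w : 'cV[R]_n) :
  inner w (u + v) = inner w u + inner w v.
Proof. by rewrite innerC innerDl !(innerC w). Qed.

Lemma innerZl (R : realFieldType) (n : nat) (a : R) (u v : 'cV[R]_n) :
  inner (a *: u) v = a * inner u v.
Proof.
by rewrite /inner mulr_sumr; apply: eq_bigr => i _; rewrite mxE mulrA.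
Qed.

Lemma innerNl (R : realFieldType) (n : nat) (u v : 'cV[R]_n) :
  inner (- u) v = - inner u v.
Proof. by rewrite -scaleN1r innerZl mulN1r. Qed.

Lemma innerBr (R : realFieldType) (n : nat) (u v w : 'cV[R]_n) :
  inner w (u - v) = inner w u - inner w v.
Proof. by rewrite innerDr (innerC w (- v)) innerNl (innerC v). Qed.

Lemma inner_mulmxl (R : realFieldType) (n : nat) (K : 'M[R]_n)
    (u v : 'cV[R]_n) :
  inner (K *m u) v = inner u (K^T *m v).
Proof.
have innerE (x y : 'cV[R]_n) : inner x y = (x^T *m y) 0 0.
  by rewrite mxE; apply: eq_bigr => i _; rewrite mxE.
by rewrite !innerE trmx_mul mulmxA.
Qed.

(** Exact second-order expansion at [u]: symmetry of [K] merges the two cross terms, so the gradient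
    is [2 (K u - b)]. *)
Lemma lasso_objectiveD (R : realFieldType) (n : nat) (K : 'M[R]_n)
    (b u h : 'cV[R]_n) :
  K^T = K ->
  lasso_objective K b (u + h) =
    lasso_objective K b u + inner (K *m h) h + 2%:R * inner (K *m u - b) h.
Proof.
move=> symK; rewrite /lasso_objective mulmxDr !innerDl !innerDr.
rewrite (inner_mulmxl K h u) symK (innerC h) innerNl.
ring.
Qed.

Lemma inner_sg_self (R : realFieldType) (n : nat) (u : 'cV[R]_n) :
  inner (map_mx Num.sg u) u = l1norm u.
Proof. by apply: eq_bigr => i _; rewrite mxE normrEsg. Qed.

(** Together with the equality at [v = u], this makes the sign vector of [u] a subgradient of the l1
    norm at [u], even where entries of [u] vanish. *)
Lemma inner_sg_le (R : realFieldType) (n : nat) (u v : 'cV[R]_n) :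
  inner (map_mx Num.sg u) v <= l1norm v.
Proof.
apply: ler_sum => i _; rewrite mxE (le_trans (ler_norm _)) // normrM normr_sg.
by rewrite ler_piMl // lern1 leq_b1.
Qed.

(** A Karush-Kuhn-Tucker condition: [- 2 s >= 0] is the multiplier of the constraint on the l1
    norm. *)
Lemma lasso_solution_sg (R : realFieldType) (n : nat) (K : 'M[R]_n)
    (b u : 'cV[R]_n) (s : R) :
  posdefmx K -> s <= 0 -> K *m u - b = s *: map_mx Num.sg u ->
  lasso_solution K b (l1norm u) u.
Proof.
move=> [symK posK] s_le0 stationary.
(* Keeping the quadratic term in this bound yields minimality, as it is nonnegative, and uniqueness,
   as it is positive for [v != u]. *)
have lower v : l1norm v <= l1norm u ->
    lasso_objective K b u + inner (K *m (v - u)) (v - u)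
      <= lasso_objective K b v.
  move=> le_vu; have := lasso_objectiveD b u (v - u) symK.
  rewrite subrKC stationary innerZl => ->; rewrite lerDl mulr_ge0 //.
  rewrite mulr_le0 // innerBr inner_sg_self subr_le0.
  exact: le_trans (inner_sg_le u v) le_vu.
split=> [|v [le_vu minv]].
  split=> // v le_vu; apply: le_trans (lower v le_vu); rewrite lerDl.
  have [->|/posK/ltW //] := eqVneq (v - u) 0.
  by rewrite mulmx0 /inner big1 // => i _; rewrite !mxE mul0r.
apply/eqP; rewrite eq_sym -subr_eq0; apply/negPn/negP => /posK.
rewrite ltNge -(lerD2l (lasso_objective K b u)) addr0.
by rewrite (le_trans (lower v le_vu) (minv u _)).
Qed.

(** An affine function of [s] with value [- num i] at 0 keeps its sign down to its first negative
    zero, and no such zero lies in the interval from [num I / den I] to 0. *)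
Lemma sgr_before_crossing (R : realFieldType) (m : nat) (num den : 'I_m -> R)
    (I i : 'I_m) (s : R) :
  nearest_negative den (fun j => num j / den j) I ->
  num I / den I < s -> s < 0 -> num i != 0 ->
  Num.sg (s * den i - num i) = Num.sg (- num i).
Proof.
move=> [_ sI_lt0 nearest] sI_lt_s s_lt0 num_neq0.
have crossing_le : den i != 0 -> num i / den i < 0 -> num i / den i < s.
  move=> den_neq0 si_lt0; apply: le_lt_trans sI_lt_s.
  by have := nearest i den_neq0 si_lt0; rewrite !ltr0_norm // lerN2.
have [num_lt0|num_gt0|num0] := ltgtP (num i) 0;
  last by rewrite num0 eqxx in num_neq0.
- rewrite !gtr0_sg ?oppr_gt0 // subr_gt0.
  (* For [den i <= 0] the product [s * den i] is nonnegative, hence above [num i]. This covers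
     [den i = 0], so the default value of the quotient never enters. *)
  have [den_le0|den_gt0] := lerP (den i) 0.
    by rewrite (lt_le_trans num_lt0) // mulr_le0 // ltW.
  by rewrite -ltr_pdivrMr // crossing_le ?gt_eqF // pmulr_llt0 ?invr_gt0.
- rewrite !ltr0_sg ?oppr_lt0 // subr_lt0.
  have [den_lt0|den_ge0] := ltrP (den i) 0.
    by rewrite -ltr_ndivrMr // crossing_le ?lt_eqF // nmulr_llt0 ?invr_lt0.
  by rewrite (le_lt_trans _ num_gt0) // mulr_le0_ge0 // ltW.
Qed.

Lemma nearest_negative_exists (R : realFieldType) (m : nat) (den s : 'I_m -> R)
    (j : 'I_m) :
  den j != 0 -> s j < 0 -> exists I, nearest_negative den s I.
Proof.
move=> den_neq0 sj_lt0.
have Pj : (den j != 0) && (s j < 0) by rewrite den_neq0.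
pose P i := (den i != 0) && (s i < 0).
case: (arg_minP (P := P) (fun i => `|s i|) Pj) => I /andP[denI sI] minI.
by exists I; split=> // k denk sk; apply: minI; apply/andP.
Qed.

Lemma cov3_cofactor3 (R : realFieldType) (J12 J13 J23 : R) :
  cov3 J12 J13 J23 *m cofactor3 J12 J13 J23 = (Delta3 J12 J13 J23)%:M.
Proof.
apply/matrixP => i j; rewrite !mxE !big_ord_recl big_ord0 !mxE /Delta3.
by case: i => [[|[|[|//]]] ?]; case: j => [[|[|[|//]]] ?] /=;
  rewrite ?mulr1n ?mulr0n; ring.
Qed.

(** For [c] the first column of the cofactor matrix, [K c] is [Delta] times the first unit vector,
    so [<K c, c> = Delta (1 - J23^2)]. *)
Lemma Delta3_gt0 (R : realFieldType) (J12 J13 J23 : R) :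
  posdefmx (cov3 J12 J13 J23) -> 0 < Delta3 J12 J13 J23.
Proof.
move=> [_ posK].
have minor_gt0 : 0 < 1 - J23 ^+ 2.
  (* At this vector the quadratic form of [K] equals [1 - J23^2]. *)
  have /posK : col3 0 (- J23) 1 != 0.
    by apply/eqP => /matrixP /(_ 2%:R 0) /eqP; rewrite !mxE /= oner_eq0.
  rewrite /inner !big_ord_recl big_ord0 !mxE !big_ord_recl !big_ord0 !mxE /=.
  by congr (_ < _); ring.
have /posK : cofactor3 J12 J13 J23 *m col3 1 0 0 != 0.
  apply/eqP => /matrixP /(_ 0 0); rewrite !mxE !big_ord_recl big_ord0 !mxE /=.
  by move=> e; move: minor_gt0; apply/negP; rewrite -leNgt -e; lra.
rewrite mulmxA cov3_cofactor3 mul_scalar_mx innerZl.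
rewrite /inner !big_ord_recl big_ord0 !mxE !big_ord_recl !big_ord0 !mxE /=.
by rewrite !mul0r !mulr0 !addr0 mul1r mulr1 pmulr_lgt0.
Qed.

(** With [w] the cofactor matrix times [v], [K w = Delta v] gives [Delta <v, w> = <K w, w>], and [w]
    is nonzero because [Delta v] is. *)
Lemma cofactor3_quad_gt0 (R : realFieldType) (J12 J13 J23 : R) (v : 'cV[R]_3) :
  posdefmx (cov3 J12 J13 J23) -> v != 0 ->
  0 < inner v (cofactor3 J12 J13 J23 *m v).
Proof.
move=> posK v_neq0; have D_gt0 := Delta3_gt0 posK.
have K_cof : cov3 J12 J13 J23 *m (cofactor3 J12 J13 J23 *m v)
    = Delta3 J12 J13 J23 *: v by rewrite mulmxA cov3_cofactor3 mul_scalar_mx.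
rewrite -(pmulr_rgt0 _ D_gt0) -innerZl -K_cof; apply: posK.2.
apply: contra_neq v_neq0 => cof_v0; move/eqP: K_cof.
by rewrite cof_v0 mulmx0 eq_sym scaler_eq0 gt_eqF // => /eqP.
Qed.

Lemma col3_eta (R : realFieldType) (u : 'cV[R]_3) :
  col3 (u 0 0) (u 1 0) (u 2%:R 0) = u.
Proof.
apply/colP => -[[|[|[|//]]] ?]; rewrite mxE /=; congr (u _ 0); exact: val_inj.
Qed.

Lemma mul_mx3_col3 (R : realFieldType)
    (a11 a12 a13 a21 a22 a23 a31 a32 a33 x1 x2 x3 : R) :
  mx3 a11 a12 a13 a21 a22 a23 a31 a32 a33 *m col3 x1 x2 x3 =
    col3 (a11 * x1 + a12 * x2 + a13 * x3)
         (a21 * x1 + a22 * x2 + a23 * x3)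
         (a31 * x1 + a32 * x2 + a33 * x3).
Proof.
apply/colP => i; rewrite !mxE !big_ord_recl big_ord0 !mxE /= addr0 addrA.
by case: i => [[|[|[|//]]] ?].
Qed.

Lemma crossing_denE (R : realFieldType) (J12 J13 J23 : R) (delta : 'cV[R]_3)
    (i : 'I_3) :
  crossing_den J12 J13 J23 delta i = (cofactor3 J12 J13 J23 *m delta) i 0.
Proof.
rewrite -[in RHS](col3_eta delta) mul_mx3_col3 mxE /crossing_den.
by case: i => [[|[|[|//]]] ?] /=; ring.
Qed.

Lemma crossing_numE (R : realFieldType) (J12 J13 J23 J14 J24 J34 : R)
    (i : 'I_3) :
  crossing_num J12 J13 J23 J14 J24 J34 i =
    - (cofactor3 J12 J13 J23 *m col3 J14 J24 J34) i 0.
Proof.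
rewrite mul_mx3_col3 mxE /crossing_num.
by case: i => [[|[|[|//]]] ?] /=; ring.
Qed.

Lemma invmx_cov3 (R : realFieldType) (J12 J13 J23 : R) :
  Delta3 J12 J13 J23 != 0 ->
  cov3 J12 J13 J23 \in unitmx /\
  invmx (cov3 J12 J13 J23)
    = (Delta3 J12 J13 J23)^-1 *: cofactor3 J12 J13 J23.
Proof.
move=> D_neq0.
have KV : cov3 J12 J13 J23 *m ((Delta3 J12 J13 J23)^-1 *: cofactor3 J12 J13 J23)
    = 1%:M by rewrite -scalemxAr cov3_cofactor3 scale_scalar_mx mulVf.
have [Ku _] := mulmx1_unit KV; split=> //.
by rewrite -[LHS]mulmx1 -KV mulKmx.
Qed.

(** In this form, multiplying the path by [K] turns it into [b + s delta]. *)
Lemma lasso_pathE (R : realFieldType) (J12 J13 J23 : R)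
    (betahat delta : 'cV[R]_3) (s : R) :
  Delta3 J12 J13 J23 != 0 ->
  lasso_path J12 J13 J23 betahat delta s =
    betahat + s *: (invmx (cov3 J12 J13 J23) *m delta).
Proof.
move=> D_neq0; rewrite (invmx_cov3 D_neq0).2 /lasso_path; congr (_ + _).
have -> : col3 (s * delta 0 0) (s * delta 1 0) (s * delta 2%:R 0) = s *: delta.
  by rewrite -[RHS]col3_eta !mxE.
by rewrite -scalemxAr -scalemxAl !scalerA mulrC.
Qed.

Theorem theorem4p2 (R : realFieldType) (J12 J13 J23 J14 J24 J34 : R) :
  let K1 := cov3 J12 J13 J23 in
  let b := col3 J14 J24 J34 in
  let betahat := invmx K1 *m b in
  let delta := map_mx Num.sg betahat in
  let beta := lasso_path J12 J13 J23 betahat delta in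
  let den := crossing_den J12 J13 J23 delta in
  let s_ := fun i => crossing_num J12 J13 J23 J14 J24 J34 i / den i in
  posdefmx K1 ->
  (forall j, betahat j 0 != 0) ->
  [/\ forall i, den i != 0 -> forall s, beta s i 0 = 0 <-> s = s_ i,
      exists I, nearest_negative den s_ I &
      forall I, nearest_negative den s_ I ->
      forall s, s_ I < s -> s < 0 ->
        0 < l1norm (beta s) /\
        lasso_solution K1 b (l1norm (beta s)) (beta s)].
Proof.
move=> K1 b betahat delta beta den s_ posK betahat_neq0.
have D_gt0 := Delta3_gt0 posK; have D_neq0 := lt0r_neq0 D_gt0.
have [Ku Kinv] := invmx_cov3 D_neq0.
set D := Delta3 J12 J13 J23 in D_gt0 D_neq0 Kinv.
set num := crossing_num J12 J13 J23 J14 J24 J34 in s_ *.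
have betahatE i : betahat i 0 = D^-1 * - num i.
  by rewrite /betahat Kinv -scalemxAl mxE /num crossing_numE opprK.
have num_neq0 i : num i != 0.
  apply: contra_neq (betahat_neq0 i) => num0.
  by rewrite betahatE num0 oppr0 mulr0.
have delta_num i : delta i 0 = Num.sg (- num i).
  by rewrite mxE betahatE sgrM gtr0_sg ?invr_gt0 // mul1r.
(* Since [D > 0], zeros and signs of the path are those of these affine functions of [s]. *)
have betaE s i : beta s i 0 = D^-1 * (s * den i - num i).
  rewrite /beta lasso_pathE // mxE betahatE mxE Kinv -scalemxAl mxE.
  by rewrite -crossing_denE -/den; ring.
split=> [i den_neq0 s||I nearI s sI_lt_s s_lt0].
- rewrite betaE; split=> [/eqP|->].
    rewrite mulf_eq0 invr_eq0 (negPf D_neq0) subr_eq0 => /eqP s_den.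
    by rewrite /s_ -s_den mulfK.
  by rewrite divfK // subrr mulr0.
- have delta_neq0 : delta != 0.
    apply: contraTneq (betahat_neq0 0) => /colP /(_ 0) /eqP.
    by rewrite !mxE sgr_eq0 => ->.
  have quad_gt0 := cofactor3_quad_gt0 posK delta_neq0.
  (* The positive sum [<delta, cofactor3 delta>] has a positive term. As [delta j] is the sign of
     [- num j], there [num j] and [den j] have opposite signs, so [s_ j < 0]. *)
  have [j] : exists j, 0 < delta j 0 * den j.
    apply/existsP; apply: contraTT quad_gt0 => /existsPn le0.
    by rewrite -leNgt; apply: sumr_le0 => j _; rewrite -crossing_denE leNgt.
  rewrite delta_num sgrN mulNr oppr_gt0 => sg_lt0.
  have den_neq0 : den j != 0.
    by apply: contraTneq sg_lt0 => ->; rewrite mulr0 ltxx.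
  apply: (nearest_negative_exists (j := j)) => //.
  by rewrite -sgr_lt0 sgrM sgr_id in sg_lt0; rewrite -sgr_lt0 sgrM sgrV.
- have sg_beta : map_mx Num.sg (beta s) = delta.
    apply/colP => i.
    rewrite mxE betaE delta_num sgrM gtr0_sg ?invr_gt0 // mul1r.
    exact: sgr_before_crossing nearI sI_lt_s s_lt0 (num_neq0 i).
  split.
    (* One nonzero coordinate suffices, and the first keeps the nonzero sign it has in [betahat]. *)
    apply: lt_le_trans (_ : `|beta s 0 0| <= _); last first.
      by rewrite /l1norm (bigD1 0) //= lerDl sumr_ge0.
    move: (congr1 (fun u : 'cV[R]_3 => u 0 0) sg_beta).
    rewrite mxE delta_num => sg0.
    by rewrite normr_gt0 -sgr_eq0 sg0 sgr_eq0 oppr_eq0.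
  apply: (lasso_solution_sg (s := s)) => //; first exact: ltW.
  rewrite sg_beta /beta lasso_pathE // mulmxDr -scalemxAr !mulKVmx //.
  by rewrite addrAC subrr add0r.
Qed.
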